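(* Let $F$ be a finite extension of $\mathbb{Q}_p$ and $k$ a finite field of characteristic $\ell\neq p$. Let $\overline\rho_i: G_F\to GL_{d_i}(k)$, $i=1,\dots,n$, be continuous representations such that $\mathrm{Hom}_{k[G_F]}(\overline\rho_i,\overline\rho_j(r))=(0)$ for all $i\neq j$ and all $r\in\mathbb{Z}$, and let $\mathcal{F}_i$ be a deformation condition for $\overline\rho_i$. Put $\overline\rho=\overline\rho_1\oplus\cdots\oplus\overline\rho_n$, $N=d_1+\cdots+d_n$, and let $\mathcal{F}$ be the full subcategory of $\mathrm{Rep}_N(G_F;k)$ of objects $(A,\rho)$ such that $\rho$ is equivalent to $\rho_1\oplus\cdots\oplus\rho_n$ with $(A,\rho_i)\in\mathcal{F}_i$ for each $i$. Then $\mathcal{F}$ is a deformation condition for $\overline\rho$; the map $((A,\rho_i))_{i}\mapsto(A,\rho_1\oplus\cdots\oplus\rho_n)$ induces an isomorphism of tangent spaces $T\mathcal{F}\cong T\mathcal{F}_1\oplus\cdots\oplus T\mathcal{F}_n$; and $\mathcal{F}$ is well-behaved if each $\mathcal{F}_i$ is well-behaved.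
   Context: $\overline\rho_j(r)$ denotes the twist of $\overline\rho_j$ by the $r$-th power of the mod $\ell$ cyclotomic character. $W=W(k)$; a CNL $W$-algebra is a complete Noetherian local $W$-algebra with residue field $k$. $\mathrm{Rep}_d(G_F;k)$: objects $(A,\rho_A)$ with $A$ a CNL $W$-algebra and $\rho_A:G_F\to GL_d(A)$ continuous; morphisms $(f,M)$ with $f:A\to B$ local and $M\in GL_d(B)$, $f\rho_A=M\rho_BM^{-1}$. A deformation condition for $\overline\rho:G_F\to GL_d(k)$ is a full subcategory $\mathcal{D}$ with: (DC0) $(k,\overline\rho)\in\mathcal{D}$ and every object reduces mod $\mathfrak m_A$ to something equivalent to $\overline\rho$; (DC1) closed under targets of morphisms; (DC2) for Artinian CNL algebras and $\alpha:A\to C$, $\beta:B\to C$ with $\beta$ small (surjective, principal kernel killed by $\mathfrak m_B$), $(A\times_CB,\rho)\in\mathcal{D}$ iff both projections are. $\mathcal{D}$ is smooth if objects over $B$ lift to objects over $A$ along any surjection $A\to B$. Its tangent space $T\mathcal{D}\subseteq H^1(G_F,\mathrm{ad}\overline\rho)$ consists of $\xi$ with $(I+\varepsilon\xi)\overline\rho$ of type $\mathcal{D}$ over $k[\varepsilon]/(\varepsilon^2)$, $\mathrm{ad}\overline\rho$ being matrices with conjugation action. $\mathcal{D}$ is well-behaved if smooth and $\dim T\mathcal{D}=\dim H^0(G_F,\mathrm{ad}\overline\rho)$. *)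

(* Defs.v *)
From HB Require Import structures.
From mathcomp Require Import all_boot all_order all_algebra all_field.
From mathcomp Require Import boolp classical_sets functions.

Set Implicit Arguments.
Unset Strict Implicit.
Unset Printing Implicit Defensive.

Import Order.TTheory GRing.Theory Num.Theory.
Local Open Scope classical_set_scope.
Local Open Scope ring_scope.

Section Ideals.
Variable A : comNzRingType.
Implicit Types I J : set A.

Definition is_ideal I : Prop :=
  [/\ I 0, forall x y, I x -> I y -> I (x + y) & forall a x, I x -> I (a * x)].

Definition ideal_mul I J : set A :=
  [set x | exists (r : nat) (a b : 'I_r -> A),
     [/\ forall i, I (a i), forall i, J (b i) & x = \sum_i a i * b i]].

Definition ideal_exp I (n : nat) : set A := iter n (ideal_mul I) setT.

Definition principal (t : A) : set A := [set x | exists a, x = a * t].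

Definition noetherian : Prop :=
  forall I, is_ideal I ->
    exists s : seq A,
      I = [set x | exists c : 'I_(size s) -> A, x = \sum_i c i * s`_i].

Definition artinian : Prop :=
  forall I : nat -> set A, (forall n, is_ideal (I n)) ->
    (forall n, I n.+1 `<=` I n) ->
    exists N, forall n, (N <= n)%N -> I n = I N.

Definition adically_complete I : Prop :=
  (forall x, (forall n, ideal_exp I n x) -> x = 0) /\
  (forall u : nat -> A,
     (forall n, exists N, forall i j, (N <= i)%N -> (N <= j)%N ->
        ideal_exp I n (u i - u j)) ->
     exists x, forall n, exists N, forall i, (N <= i)%N ->
        ideal_exp I n (u i - x)).

Lemma ideal_exp0 I n : ideal_exp I n 0.
Proof.
case: n => [|n] //=; exists 0%N, (fun=> 0), (fun=> 0).
by split; try (by case); rewrite big_ord0.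
Qed.

Lemma nilpotent_complete I n :
  (forall x, ideal_exp I n x -> x = 0) -> adically_complete I.
Proof.
move=> In0; split=> [x /(_ n) /In0 //|u /(_ n)[N uN]].
exists (u N) => m; exists N => i Ni.
have /In0 -> := uN i N Ni (leqnn N).
exact: ideal_exp0.
Qed.

End Ideals.

Lemma ideal_exp_morph (A B : comNzRingType) (f : {rmorphism A -> B})
    (I : set A) (J : set B) (IJ : forall x, I x -> J (f x)) n x :
  ideal_exp I n x -> ideal_exp J n (f x).
Proof.
elim: n x => [|n IHn] x //= [r [a [b [Ia Ib ->]]]].
exists r, (f \o a), (f \o b); split=> [i|i|] /=.
- exact: IJ.
- exact: IHn.
- by rewrite rmorph_sum; apply: eq_bigr => i _; rewrite rmorphM.
Qed.

Lemma finite_noetherian (A : comNzRingType) (e : seq A) :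
  (forall x, x \in e) -> noetherian A.
Proof.
move=> eP I [I0 ID IM]; pose s := [seq x <- e | `[<I x>]]; exists s.
apply/seteqP; split=> [x Ix|x [c ->]] /=.
  have xs : x \in s by rewrite mem_filter eP andbT; apply/asboolP.
  have /[dup] xi := xs; rewrite -index_mem => lt_xs.
  exists (fun i => if i == Ordinal lt_xs then 1 else 0).
  rewrite (bigD1 (Ordinal lt_xs)) //= eqxx mul1r nth_index // big1 ?addr0 //.
  by move=> i /negPf ->; rewrite mul0r.
apply: (big_ind I) => // i _; apply: IM.
have := mem_nth 0 (ltn_ord i); rewrite mem_filter => /andP[/asboolP].
by [].
Qed.

(* The set of non-units; it is the maximal ideal exactly when A is local. *)
Definition max_ideal (A : comUnitRingType) : set A :=
  [set a | a \notin GRing.unit].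

Definition has_dim (K : fieldType) (V : lmodType K) (S : set V) (n : nat) :
    Prop :=
  exists e : 'I_n -> V,
    (forall c : 'I_n -> K, \sum_i c i *: e i = 0 -> forall i, c i = 0) /\
    S = [set v | exists c : 'I_n -> K, v = \sum_i c i *: e i].

Definition padic_abs (p : nat) (q : rat) : rat :=
  if q == 0 then 0
  else p%:R ^+ logn p `|denq q|%N / p%:R ^+ logn p `|numq q|%N.

(* Q_p is the completion of Q for the p-adic absolute value, which determines
   it up to a unique isomorphism. Its absolute value is rational-valued. *)
Record padicField (p : nat) := PadicField {
  padic_sort :> fieldType;
  padic_emb : {rmorphism rat -> padic_sort};
  padic_norm : padic_sort -> rat;
  padic_norm_ge0 : forall x, 0 <= padic_norm x;
  padic_norm_eq0 : forall x, padic_norm x = 0 -> x = 0;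
  padic_normM : forall x y, padic_norm (x * y) = padic_norm x * padic_norm y;
  padic_normD : forall x y, padic_norm (x + y) <= padic_norm x + padic_norm y;
  padic_norm_emb : forall q, padic_norm (padic_emb q) = padic_abs p q;
  padic_dense : forall x (e : rat), 0 < e ->
    exists q, padic_norm (x - padic_emb q) < e;
  padic_complete : forall u : nat -> padic_sort,
    (forall e : rat, 0 < e -> exists N, forall i j,
       (N <= i)%N -> (N <= j)%N -> padic_norm (u i - u j) < e) ->
    exists x, forall e : rat, 0 < e -> exists N, forall i,
       (N <= i)%N -> padic_norm (u i - x) < e
}.

Record algClosure (F : fieldType) := AlgClosure {
  closure_sort :> closedFieldType;
  closure_emb : {rmorphism F -> closure_sort};
  closure_algebraic : forall x : closure_sort, algebraicOver closure_emb x
}.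

(* For F of characteristic 0 an algebraic closure is a separable closure. *)
Record gal (F : fieldType) (Fbar : algClosure F) := Gal {
  gal_fun :> Fbar -> Fbar;
  gal_zmod : zmod_morphism gal_fun;
  gal_monoid : monoid_morphism gal_fun;
  gal_bij : bijective gal_fun;
  gal_fix : forall x, gal_fun (closure_emb Fbar x) = closure_emb Fbar x
}.

Section GaloisGroup.
Variables (F : fieldType) (Fbar : algClosure F).
Local Notation G := (gal Fbar).

HB.instance Definition _ := gen_eqMixin G.
HB.instance Definition _ := gen_choiceMixin G.

HB.instance Definition _ (g : G) :=
  GRing.isZmodMorphism.Build _ _ (gal_fun g) (gal_zmod g).
HB.instance Definition _ (g : G) :=
  GRing.isMonoidMorphism.Build _ _ (gal_fun g) (gal_monoid g).

Lemma gal_inj (g h : G) : gal_fun g =1 gal_fun h -> g = h.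
Proof.
case: g h => [g g1 g2 g3 g4] [h h1 h2 h3 h4] /= /funext gh.
by case: _ / gh in h1 h2 h3 h4 *; congr Gal; apply: Prop_irrelevance.
Qed.

Program Definition gal_one : G := @Gal _ Fbar id _ _ _ _.
Next Obligation. by []. Qed.
Next Obligation. by []. Qed.
Next Obligation. by exists id. Qed.

Program Definition gal_mul (g h : G) : G :=
  @Gal _ Fbar (gal_fun g \o gal_fun h) _ _ _ _.
Next Obligation. by move=> x y /=; rewrite !rmorphB. Qed.
Next Obligation. by split=> [|x y] /=; rewrite ?rmorph1 ?rmorphM. Qed.
Next Obligation. exact: bij_comp (gal_bij g) (gal_bij h). Qed.
Next Obligation. by rewrite !gal_fix. Qed.

Lemma gal_inv_ex (g : G) : exists g' : Fbar -> Fbar,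
  cancel (gal_fun g) g' /\ cancel g' (gal_fun g).
Proof. by case: (gal_bij g) => g' gK g'K; exists g'. Qed.

Definition gal_inv_fun (g : G) : Fbar -> Fbar := sval (cid (gal_inv_ex g)).

Lemma gal_inv_funK (g : G) : cancel (gal_fun g) (gal_inv_fun g).
Proof. exact: (svalP (cid (gal_inv_ex g))).1. Qed.

Lemma gal_funK (g : G) : cancel (gal_inv_fun g) (gal_fun g).
Proof. exact: (svalP (cid (gal_inv_ex g))).2. Qed.

Program Definition gal_inv (g : G) : G := @Gal _ Fbar (gal_inv_fun g) _ _ _ _.
Next Obligation.
move=> x y; apply: (can_inj (gal_inv_funK g)).
by rewrite rmorphB /= !gal_funK.
Qed.
Next Obligation.
by split=> [|x y]; apply: (can_inj (gal_inv_funK g));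
  rewrite ?rmorph1 ?rmorphM /= !gal_funK.
Qed.
Next Obligation.
by exists (gal_fun g); [exact: gal_funK|exact: gal_inv_funK].
Qed.
Next Obligation.
by apply: (can_inj (gal_inv_funK g)); rewrite gal_funK gal_fix.
Qed.

Lemma gal_mulA : associative gal_mul.
Proof. by move=> f g h; apply: gal_inj. Qed.
Lemma gal_mul1g : left_id gal_one gal_mul.
Proof. by move=> g; apply: gal_inj. Qed.
Lemma gal_mulg1 : right_id gal_one gal_mul.
Proof. by move=> g; apply: gal_inj. Qed.
Lemma gal_mulVg : left_inverse gal_one gal_inv gal_mul.
Proof. by move=> g; apply: gal_inj => x; exact: (gal_inv_funK g x). Qed.
Lemma gal_mulgV : right_inverse gal_one gal_inv gal_mul.
Proof. by move=> g; apply: gal_inj => x; exact: (gal_funK g x). Qed.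

HB.instance Definition _ :=
  isGroup.Build G gal_mulA gal_mul1g gal_mulg1 gal_mulVg gal_mulgV.

(* Neighbourhoods in the Krull topology: the automorphisms that agree with g
   on a finite set s form the coset g Gal(Fbar / F(s)). *)
Definition krull_nbhs (g : G) (U : set G) : Prop :=
  exists s : seq Fbar, forall h : G, {in s, h =1 g} -> U h.

Lemma krull_nbhs_forall (n : nat) (g : G) (U : 'I_n -> set G) :
  (forall i, krull_nbhs g (U i)) -> krull_nbhs g [set h | forall i, U i h].
Proof.
move=> /choice[s sP]; exists (flatten [seq s i | i <- enum 'I_n]) => h hs i.
apply: sP => x xs; apply: hs; apply/flattenP; exists (s i) => //.
by apply/mapP; exists i; rewrite ?mem_enum.
Qed.

Lemma krull_nbhsS (g : G) (U V : set G) :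
  U `<=` V -> krull_nbhs g U -> krull_nbhs g V.
Proof. by move=> UV [s sP]; exists s => h /sP /UV. Qed.

Lemma krull_nbhsI (g : G) (U V : set G) :
  krull_nbhs g U -> krull_nbhs g V -> krull_nbhs g (U `&` V).
Proof.
move=> [s sP] [t tP]; exists (s ++ t) => h hst.
by split; [apply: sP|apply: tP] => x xs; apply: hst; rewrite mem_cat xs ?orbT.
Qed.

(* The mod ell cyclotomic character with values in k, a field of
   characteristic ell: g acts on the ell-th roots of unity of Fbar by
   raising to the power cyclo_char g. *)
Definition cyclo_exp (ell : nat) (g : G) : nat :=
  xget 0%N [set a : nat | forall z : Fbar, z ^+ ell = 1 -> g z = z ^+ a].

Definition cyclo_char (ell : nat) (k : fieldType) (g : G) : k :=
  (cyclo_exp ell g)%:R.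

End GaloisGroup.

(* W(k) for a perfect field k of characteristic ell: the strict ell-ring with
   residue field k, unique up to a unique isomorphism. *)
Record wittRing (k : fieldType) (ell : nat) := WittRing {
  witt_sort :> comNzRingType;
  witt_res : {rmorphism witt_sort -> k};
  witt_res_surj : forall x, exists w, witt_res w = x;
  witt_res_ker : forall w, witt_res w = 0 <-> principal ell%:R w;
  witt_torsion_free : forall w : witt_sort, ell%:R * w = 0 -> w = 0;
  witt_complete : adically_complete (principal (ell%:R : witt_sort))
}.

Section CNL.
Variables (k : finFieldType) (ell : nat) (W : wittRing k ell).

Record cnl := Cnl {
  cnl_sort :> comUnitRingType;
  cnl_alg : {rmorphism W -> cnl_sort};
  cnl_res : {rmorphism cnl_sort -> k};
  cnl_local : is_ideal (@max_ideal cnl_sort);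
  cnl_noetherian : noetherian cnl_sort;
  cnl_complete : adically_complete (@max_ideal cnl_sort);
  cnl_res_surj : forall x, exists a, cnl_res a = x;
  cnl_res_ker : forall a, cnl_res a = 0 <-> max_ideal a;
  cnl_res_alg : forall w, cnl_res (cnl_alg w) = witt_res W w
}.

Record cnl_hom (A B : cnl) := CnlHom {
  cnl_hom_fun :> {rmorphism A -> B};
  cnl_hom_alg : forall w, cnl_hom_fun (cnl_alg A w) = cnl_alg B w;
  cnl_hom_local : forall a, max_ideal a -> max_ideal (cnl_hom_fun a)
}.

Lemma field_max_ideal (a : k) : max_ideal a <-> a = 0.
Proof.
by rewrite /max_ideal /= unitfE negbK; split=> [/eqP|->] //; rewrite eqxx.
Qed.

Definition k_cnl : cnl.
Proof.
apply: (@Cnl k (witt_res W) idfun).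
- split=> [|x y|a x]; rewrite !field_max_ideal //.
    by move=> -> ->; rewrite addr0.
  by move=> ->; rewrite mulr0.
- by apply: (@finite_noetherian _ (enum k)) => x; rewrite mem_enum.
- apply: (@nilpotent_complete _ _ 1%N) => x /= [r [a [b [am _ ->]]]].
  by apply: big1 => i _; have /field_max_ideal -> := am i; rewrite mul0r.
- by move=> x; exists x.
- by move=> a; rewrite field_max_ideal.
- by [].
Defined.

(* k[eps]/(eps^2), with eps = 'qX *)
Definition dual : comUnitRingType := {poly %/ ('X^2 : {poly k})}.
Definition dual_eps : dual := 'qX.
Definition dual_const : {rmorphism k -> dual} := qpolyC ('X^2 : {poly k}).
Definition dual_res (a : dual) : k := (a : {poly k})`_0.

Lemma dual_coefM (a b : dual) i : (i < 2)%N ->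
  ((a * b : dual) : {poly k})`_i = ((a : {poly k}) * (b : {poly k}))`_i.
Proof.
move=> lt_i2; rewrite poly_of_qpolyM.
move: (a : {poly k}) (b : {poly k}) => p q; rewrite mk_monic_Xn.
rewrite [in RHS](Pdiv.RingMonic.rdivp_eq (monicXn k 2) (p * q)).
by rewrite coefD coefMXn lt_i2 add0r.
Qed.

Lemma dual_resB : zmod_morphism dual_res.
Proof. by move=> a b; rewrite /dual_res /= coefB. Qed.

Lemma dual_resM : monoid_morphism dual_res.
Proof.
split=> [|a b]; first by rewrite /dual_res /= coefC.
by rewrite /dual_res dual_coefM // coef0M.
Qed.

HB.instance Definition _ := GRing.isZmodMorphism.Build dual k dual_res dual_resB.
HB.instance Definition _ :=
  GRing.isMonoidMorphism.Build dual k dual_res dual_resM.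

Lemma dual_resC (x : k) : dual_res (dual_const x) = x.
Proof. exact: (coefC x 0%N). Qed.

Lemma dual_max_ideal (a : dual) : dual_res a = 0 <-> max_ideal a.
Proof.
have -> : max_ideal a = (~~ coprimep (mk_monic 'X^2) (a : {poly k})) :> Prop.
  by [].
rewrite /dual_res; move: (a : {poly k}) => p.
rewrite mk_monic_Xn coprimep_pexpl // coprimep_sym -['X]subr0 coprimep_XsubC.
by rewrite negbK /root horner_coef0; split=> [->|/eqP].
Qed.

Lemma dual_eq0 (a : dual) :
  (a : {poly k})`_0 = 0 -> (a : {poly k})`_1 = 0 -> a = 0.
Proof.
move=> a0 a1; apply: val_inj; apply/polyP => -[|[|i]] /=; rewrite coef0 //.
rewrite nth_default //; have := size_mk_monic a.
by move: (a : {poly k}) => p; rewrite mk_monic_Xn size_polyXn ltnS => /leq_trans; apply.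
Qed.

Lemma dual_mulI (a b : dual) : dual_res a = 0 -> dual_res b = 0 -> a * b = 0.
Proof.
rewrite /dual_res => a0 b0; apply: dual_eq0; rewrite dual_coefM //.
  by rewrite coef0M a0 mul0r.
by rewrite coefM !big_ord_recl big_ord0 /= a0 b0 mul0r mulr0 !addr0.
Qed.

Definition dual_cnl : cnl.
Proof.
apply: (@Cnl dual (dual_const \o witt_res W) dual_res).
- split=> [|x y|a x]; rewrite -!dual_max_ideal ?rmorph0 ?rmorphD ?rmorphM //=.
    by move=> -> ->; rewrite addr0.
  by move=> ->; rewrite mulr0.
- apply: (@finite_noetherian _ (enum {poly %/ ('X^2 : {poly k})})) => x.
  by rewrite mem_enum.
- apply: (@nilpotent_complete _ _ 2%N) => x /= [r [a [b [am bm ->]]]].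
  apply: big1 => i _; apply: dual_mulI; first exact/dual_max_ideal.
  have [s [c [e [cm _ ->]]]] := bm i; rewrite rmorph_sum big1 // => j _.
  by rewrite rmorphM /=; have /dual_max_ideal -> := cm j; rewrite mul0r.
- by move=> x; exists (dual_const x); exact: dual_resC.
- by move=> a; exact: dual_max_ideal.
- by move=> w; exact: dual_resC.
Defined.

End CNL.

Section Cohomology.
Variables (k : fieldType) (F : fieldType) (Fbar : algClosure F) (d : nat).
Variable rho : gal Fbar -> 'M[k]_d.

Definition ad_act (g : gal Fbar) (X : 'M[k]_d) : 'M[k]_d :=
  rho g *m X *m invmx (rho g).

Lemma ad_act_linear g : linear (ad_act g).
Proof.
by move=> a X Y; rewrite /ad_act mulmxDr mulmxDl -scalemxAr -scalemxAl.
Qed.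

HB.instance Definition _ g :=
  GRing.isLinear.Build k 'M[k]_d 'M[k]_d *:%R (ad_act g) (ad_act_linear g).

Definition H0 : set 'M[k]_d := [set X | forall g, ad_act g X = X].

(* k carries the discrete topology *)
Definition is_cocycle (z : gal Fbar -> 'M[k]_d) : Prop :=
  (forall g, krull_nbhs g [set h | z h = z g]) /\
  (forall g h, z (g * h)%g = z g + ad_act g (z h)).

Definition cocycle_pred : {pred (gal Fbar -> 'M[k]_d)} :=
  fun z => `[< is_cocycle z >].

Lemma cocycle_submod_closed : submod_closed cocycle_pred.
Proof.
split=> [|a y z /asboolP[yc yM] /asboolP[zc zM]]; apply/asboolP; split.
- by move=> g; exists [::].
- by move=> g h; rewrite /= linear0 addr0.
- move=> g; apply: krull_nbhsS (krull_nbhsI (yc g) (zc g)).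
  by move=> h [/= yh zh]; rewrite !fctE yh zh.
- move=> g h; rewrite !fctE yM zM linearP scalerDr.
  by rewrite addrACA.
Qed.

HB.instance Definition _ :=
  GRing.isSubmodClosed.Build k (gal Fbar -> 'M[k]_d) cocycle_pred
    cocycle_submod_closed.

Record cocycle := Cocycle {
  cocycle_fun :> gal Fbar -> 'M[k]_d;
  cocycleP : cocycle_fun \in cocycle_pred
}.

HB.instance Definition _ := [isSub for cocycle_fun].
HB.instance Definition _ := [Choice of cocycle by <:].
HB.instance Definition _ := [SubChoice_isSubLmodule of cocycle by <:].

Definition coboundary_pred : {pred cocycle} :=
  fun z => `[< exists X, forall g, z g = ad_act g X - X >].

Lemma coboundary_submod_closed : submod_closed coboundary_pred.
Proof.
split=> [|a y z /asboolP[X yX] /asboolP[Y zY]]; apply/asboolP.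
  by exists 0 => g; rewrite linear0 subr0.
exists (a *: X + Y) => g.
have -> : (a *: y + z : cocycle) g = a *: y g + z g by [].
by rewrite yX zY linearP scalerBr opprD addrACA.
Qed.

HB.instance Definition _ :=
  GRing.isSubmodClosed.Build k cocycle coboundary_pred coboundary_submod_closed.

Local Open Scope quotient_scope.

Definition H1 : Type := Quotient.quot coboundary_pred.

HB.instance Definition _ := GRing.Zmodule.on H1.

Definition H1_class (z : cocycle) : H1 := \pi_(Quotient.quot coboundary_pred) z.

Lemma H1_classP (y z : cocycle) :
  H1_class y = H1_class z <-> exists X, forall g, (y - z) g = ad_act g X - X.
Proof.
have yzE : (y - z \in coboundary_pred) = (H1_class y == H1_class z).
  exact: Quotient.idealrBE.
split=> [/eqP|yz]; first by rewrite -yzE => /asboolP.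
by apply/eqP; rewrite -yzE; apply/asboolP.
Qed.

Lemma H1_class_surj (c : H1) : exists z, H1_class z = c.
Proof. by exists (repr c); exact: reprK. Qed.

Definition H1_scale (a : k) (c : H1) : H1 :=
  H1_class (a *: repr (c : Quotient.quot coboundary_pred)).

Lemma H1_classZ a z : H1_class (a *: z) = H1_scale a (H1_class z).
Proof.
apply/eqP; rewrite -Quotient.idealrBE -scalerBr rpredZ //.
by rewrite Quotient.idealrBE reprK.
Qed.

Lemma H1_classD y z : H1_class (y + z) = H1_class y + H1_class z.
Proof. exact: raddfD. Qed.

Lemma H1_scalerA a b c : H1_scale a (H1_scale b c) = H1_scale (a * b) c.
Proof.
by have [z <-] := H1_class_surj c; rewrite -!H1_classZ scalerA.
Qed.

Lemma H1_scale1r : left_id 1 H1_scale.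
Proof.
by move=> c; have [z <-] := H1_class_surj c; rewrite -H1_classZ scale1r.
Qed.

Lemma H1_scalerDr : right_distributive H1_scale +%R.
Proof.
move=> a b c; have [y <-] := H1_class_surj b; have [z <-] := H1_class_surj c.
by rewrite -H1_classD -!H1_classZ scalerDr H1_classD.
Qed.

Lemma H1_scalerDl c : {morph H1_scale^~ c : a b / a + b}.
Proof.
move=> a b; have [z <-] := H1_class_surj c.
by rewrite -!H1_classZ scalerDl H1_classD.
Qed.

HB.instance Definition _ := GRing.Zmodule_isLmodule.Build k H1
  H1_scalerA H1_scale1r H1_scalerDr H1_scalerDl.

End Cohomology.

Section Representations.
Variables (k : finFieldType) (ell : nat) (W : wittRing k ell).
Variables (F : fieldType) (Fbar : algClosure F).
Local Notation G := (gal Fbar).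

(* Objects of Rep_d over A. The values are invertible matrices by rep1 and
   repM, and A has its maximal-adic topology. *)
Record rep (A : cnl W) (d : nat) := Rep {
  rep_fun :> G -> 'M[A]_d;
  rep1 : rep_fun 1%g = 1%:M;
  repM : forall g h, rep_fun (g * h)%g = rep_fun g *m rep_fun h;
  rep_continuous : forall g n, krull_nbhs g
    [set h | forall i j, ideal_exp (@max_ideal A) n (rep_fun h i j - rep_fun g i j)]
}.

Program Definition rep_map (A B : cnl W) (f : cnl_hom A B) (d : nat)
    (r : rep A d) : rep B d :=
  @Rep B d (fun g => map_mx f (r g)) _ _ _.
Next Obligation. by rewrite rep1 map_mx1. Qed.
Next Obligation. by rewrite repM map_mxM. Qed.
Next Obligation.
apply: krull_nbhsS (rep_continuous r g n) => h hg i j; rewrite !mxE -rmorphB.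
exact: (ideal_exp_morph (@cnl_hom_local _ _ _ _ _ f) (hg i j)).
Qed.

Lemma mxdiag_entry (A : cnl W) n (d : 'I_n -> nat) (B : forall i, 'M[A]_(d i))
    (I : set A) : I 0 -> (forall i a b, I (B i a b)) ->
  forall a b, I ((\mxdiag_i B i) a b).
Proof.
move=> I0 IB a b; rewrite mxE; case: ifP => _; last by rewrite mxE.
rewrite /conform_mx; case: eqP => [e|_]; last by rewrite mxE.
by case: eqP => [e'|_]; rewrite ?castmxE ?mxE.
Qed.

Program Definition rep_dsum (A : cnl W) (n : nat) (d : 'I_n -> nat)
    (r : forall i, rep A (d i)) : rep A (\sum_i d i) :=
  @Rep A _ (fun g => \mxdiag_i r i g) _ _ _.
Next Obligation.
by under eq_mxdiag do rewrite rep1; rewrite mxdiagZ.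
Qed.
Next Obligation.
under eq_mxdiag do rewrite repM.
rewrite {3}/mxdiag mul_mxdiag_mxblock; apply: eq_mxblock => i j.
case: eqP => [->|_]; rewrite ?conform_mx_id ?mulmx0 //.
Qed.
Next Obligation.
have := krull_nbhs_forall (fun i => rep_continuous (r i) g n0).
apply: krull_nbhsS => h /= hg i j.
have -> : (\mxdiag_i r i h) i j - (\mxdiag_i r i g) i j =
          (\mxdiag_i (r i h - r i g)) i j by rewrite mxdiagB !mxE.
apply: mxdiag_entry; first exact: ideal_exp0.
by move=> l a b; rewrite !mxE; apply: hg.
Qed.

Definition equivalent (R : comUnitRingType) (d : nat) (r r' : G -> 'M[R]_d) :
    Prop :=
  exists2 M : 'M[R]_d, M \in unitmx & forall g, r g = M *m r' g *m invmx M.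

(* A full subcategory of Rep_d is given by its class of objects. *)
Definition rep_subcat (d : nat) := forall A : cnl W, rep A d -> Prop.

Definition small (A B : cnl W) (f : cnl_hom A B) : Prop :=
  (forall b, exists a, f a = b) /\
  exists t : A, [set a | f a = 0] = principal t /\
    forall m, max_ideal m -> m * t = 0.

(* A fibre product of CNL algebras is determined up to a unique isomorphism, so
   E ranges over all its models instead of being a chosen subring of A * B. *)
Definition is_fibre_product (A B C E : cnl W) (alpha : cnl_hom A C)
    (beta : cnl_hom B C) (pA : cnl_hom E A) (pB : cnl_hom E B) : Prop :=
  (forall x, alpha (pA x) = beta (pB x)) /\
  (forall a b, alpha a = beta b -> exists! x, pA x = a /\ pB x = b).

Record deformation_condition (d : nat) (rhobar : rep (k_cnl W) d)
    (D : rep_subcat d) : Prop := DeformationCondition {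
  dc0 : D (k_cnl W) rhobar;
  dc0_res : forall (A : cnl W) (r : rep A d), D A r ->
    @equivalent k d (fun g => map_mx (cnl_res A) (r g)) rhobar;
  dc1 : forall (A B : cnl W) (f : cnl_hom A B) (M : 'M[B]_d)
      (r : rep A d) (r' : rep B d),
    M \in unitmx -> (forall g, map_mx f (r g) = M *m r' g *m invmx M) ->
    D A r -> D B r';
  dc2 : forall (A B C E : cnl W) (alpha : cnl_hom A C) (beta : cnl_hom B C)
      (pA : cnl_hom E A) (pB : cnl_hom E B),
    artinian A -> artinian B -> artinian C -> small beta ->
    is_fibre_product alpha beta pA pB ->
    forall r : rep E d, D E r <-> D A (rep_map pA r) /\ D B (rep_map pB r)
}.

Definition smooth (d : nat) (D : rep_subcat d) : Prop :=
  forall (A B : cnl W) (f : cnl_hom A B), (forall b, exists a, f a = b) ->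
  forall r : rep B d, D B r ->
  exists2 r' : rep A d, D A r' & forall g, map_mx f (r' g) = r g.

Definition H1ad (d : nat) (rhobar : rep (k_cnl W) d) : lmodType k :=
  @H1 k F Fbar d rhobar.

(* r = (1 + eps z) rhobar over k[eps] for some cocycle z in the class c *)
Definition first_order (d : nat) (rhobar : rep (k_cnl W) d)
    (r : rep (dual_cnl W) d) (c : H1ad rhobar) : Prop :=
  exists2 z : cocycle rhobar, H1_class z = c &
    forall g, r g = (1%:M + dual_eps k *: map_mx (dual_const k) (z g))
                      *m map_mx (dual_const k) (rhobar g).

Definition tangent (d : nat) (rhobar : rep (k_cnl W) d) (D : rep_subcat d) :
    set (H1ad rhobar) :=
  [set c | exists2 r, first_order r c & D (dual_cnl W) r].

Definition well_behaved (d : nat) (rhobar : rep (k_cnl W) d)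
    (D : rep_subcat d) : Prop :=
  smooth D /\
  exists m, has_dim (@tangent d rhobar D) m /\ has_dim (@H0 k F Fbar d rhobar) m.

Definition dsum_subcat (n : nat) (d : 'I_n -> nat)
    (D : forall i, rep_subcat (d i)) : rep_subcat (\sum_i d i) :=
  fun A r => exists2 rs : forall i, rep A (d i),
    forall i, D i A (rs i) & equivalent r (rep_dsum rs).

Definition twist (d : nat) (rhobar : rep (k_cnl W) d) (m : int) (g : G) :
    'M[k]_d :=
  cyclo_char ell k g ^ m *: (rhobar g : 'M[k]_d).

Definition intertwiner (d e : nat) (r : G -> 'M[k]_d) (r' : G -> 'M[k]_e)
    (X : 'M[k]_(e, d)) : Prop :=
  forall g, X *m r g = r' g *m X.

End Representations.

Arguments tangent {k ell W F Fbar d} rhobar D _.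

(* Main.v *)
Require Import Defs.
From HB Require Import structures.
From mathcomp Require Import all_boot all_order all_algebra all_field.
From mathcomp Require Import boolp classical_sets functions.

Set Implicit Arguments.
Unset Strict Implicit.
Unset Printing Implicit Defensive.

Import GRing.Theory.
Local Open Scope classical_set_scope.
Local Open Scope ring_scope.

(* Only the case r = 0 of the vanishing of Hom matters. Over any CNL algebra it
   forces every intertwiner between two sums of lifts of the rhobar_i to be
   block diagonal (intertwiner_local_eq0, a Nakayama argument on the ideal
   spanned by the entries of an off-diagonal block).
   Hence, for a representation over a fibre product A x_C B that is decomposable
   over A and over B, the two decompositions differ over C by a block diagonal
   matrix; lifted blockwise along the surjection B -> C, it lets the two changes
   of basis be glued. Over k[eps] the same rigidity normalises the change of
   basis to 1 + eps X, and then the two cocycles differ by the coboundary of X.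
   Finally H^0(ad rhobar) is the sum of the H^0(ad rhobar_i), so the dimensions
   add up on both sides; smoothness lifts the summands and the change of basis
   separately. *)

(** * Algebra of block diagonal matrices *)

Section BlockDiagonal.
Variables (n : nat) (d : 'I_n -> nat).

Lemma submxblock_mxdiag_neq (V : nmodType) (B : forall i, 'M[V]_(d i)) i j :
  i != j -> submxblock (\mxdiag_i B i) i j = 0.
Proof. by move=> /negPf ij; rewrite /mxdiag mxblockK ij. Qed.

Lemma mxdiag_submxblock (V : nmodType) (M : 'M[V]_(\sum_i d i)) :
  (forall i j, i != j -> submxblock M i j = 0) ->
  M = \mxdiag_i submxblock M i i.
Proof.
move=> M0; apply/mxblockP => i j; have [<-|ij] := eqVneq i j.
  by rewrite submxblock_diag.
by rewrite submxblock_mxdiag_neq ?M0.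
Qed.

Lemma mxdiag_inj (V : nmodType) (B B' : forall i, 'M[V]_(d i)) :
  \mxdiag_i B i = \mxdiag_i B' i -> forall i, B i = B' i.
Proof. by move/eq_mxdiagP. Qed.

Lemma submxblock_mul_mxdiagl (R : pzSemiRingType) (B : forall i, 'M[R]_(d i))
    (M : 'M[R]_(\sum_i d i)) i j :
  submxblock (\mxdiag_i B i *m M) i j = B i *m submxblock M i j.
Proof. by rewrite -{1}[M]submxblockK mul_mxdiag_mxblock mxblockK. Qed.

Lemma submxblock_mul_mxdiagr (R : pzSemiRingType) (B : forall i, 'M[R]_(d i))
    (M : 'M[R]_(\sum_i d i)) i j :
  submxblock (M *m \mxdiag_i B i) i j = submxblock M i j *m B j.
Proof. by rewrite -{1}[M]submxblockK mul_mxblock_mxdiag mxblockK. Qed.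

Lemma mul_mxdiag (R : pzSemiRingType) (B B' : forall i, 'M[R]_(d i)) :
  \mxdiag_i B i *m \mxdiag_i B' i = \mxdiag_i (B i *m B' i).
Proof.
apply/mxblockP => i j; rewrite submxblock_mul_mxdiagl.
have [<-|ij] := eqVneq i j; first by rewrite !submxblock_diag.
by rewrite !submxblock_mxdiag_neq ?mulmx0.
Qed.

Lemma scale_mxdiag (R : pzSemiRingType) a (B : forall i, 'M[R]_(d i)) :
  a *: \mxdiag_i B i = \mxdiag_i (a *: B i).
Proof.
rewrite -mul_scalar_mx -mxdiagZ mul_mxdiag; apply: eq_mxdiag => i.
by rewrite mul_scalar_mx.
Qed.

Lemma submxblock_map (V V' : Type) (f : V -> V') (M : 'M[V]_(\sum_i d i)) i j :
  submxblock (map_mx f M) i j = map_mx f (submxblock M i j).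
Proof. by apply/matrixP => a b; rewrite !mxE. Qed.

Lemma map_mxdiag (V V' : nmodType) (f : V -> V') (f0 : f 0 = 0)
    (B : forall i, 'M[V]_(d i)) :
  map_mx f (\mxdiag_i B i) = \mxdiag_i map_mx f (B i).
Proof.
apply/mxblockP => i j; rewrite submxblock_map.
have [<-|ij] := eqVneq i j; first by rewrite !submxblock_diag.
rewrite !submxblock_mxdiag_neq //.
by apply/matrixP => a b; rewrite !mxE.
Qed.

Lemma mxdiag_unitmx (R : comUnitRingType) (B : forall i, 'M[R]_(d i)) :
  (\mxdiag_i B i \in unitmx) <-> (forall i, B i \in unitmx).
Proof.
split=> [uB i|uB].
  (* The inverse is not assumed block diagonal: with a block diagonal left factor, its [(i, i)]
     block is already a right inverse of [B i]. *)
  have /(congr1 (fun M => submxblock M i i)) := mulmxV uB.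
  rewrite submxblock_mul_mxdiagl -mxdiagZ submxblock_diag.
  by move=> /mulmx1_unit[].
have : \mxdiag_i B i *m \mxdiag_i invmx (B i) = 1%:M.
  rewrite mul_mxdiag -mxdiagZ; apply: eq_mxdiag => i.
  by rewrite mulmxV.
by move=> /mulmx1_unit[].
Qed.

Lemma mulmx1_invmx (R : comUnitRingType) m (A B : 'M[R]_m) :
  A *m B = 1%:M -> invmx A = B.
Proof.
move=> AB; have [uA _] := mulmx1_unit AB.
by rewrite -[LHS]mulmx1 -AB mulKmx.
Qed.

Lemma invmx_mxdiag (R : comUnitRingType) (B : forall i, 'M[R]_(d i)) :
  (forall i, B i \in unitmx) ->
  invmx (\mxdiag_i B i) = \mxdiag_i invmx (B i).
Proof.
move=> uB; apply: mulmx1_invmx; rewrite mul_mxdiag -mxdiagZ.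
by apply: eq_mxdiag => i; rewrite mulmxV.
Qed.

End BlockDiagonal.

(** Clears the inverse, so that a change of basis can be treated as an intertwining identity and
    pushed through ring maps. *)
Lemma conj_unitmxP (R : comUnitRingType) m (M X Y : 'M[R]_m) : M \in unitmx ->
  X = M *m Y *m invmx M <-> X *m M = M *m Y.
Proof.
by move=> uM; split=> [->|<-]; rewrite ?mulmxKV ?mulmxK.
Qed.

Lemma conj_unitmx_sym (R : comUnitRingType) m (M X Y : 'M[R]_m) : M \in unitmx ->
  X = M *m Y *m invmx M -> Y = invmx M *m X *m invmx (invmx M).
Proof. by move=> uM ->; rewrite invmxK !mulmxA mulVmx // mul1mx mulmxKV. Qed.

(** * Vanishing of intertwiners over a local ring *)

Section LocalRing.
Variables (R : comUnitRingType) (K : fieldType) (res : {rmorphism R -> K}).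
Hypothesis res_ker : forall a, res a = 0 <-> max_ideal a.

Lemma res_unitP a : (res a != 0) = (a \in GRing.unit).
Proof.
apply/idP/idP => [ra|]; last by move=> /(rmorph_unit res); rewrite unitfE.
by apply: contraNT ra => /res_ker ->.
Qed.

(** Since [c l] is a unit, the relation expresses [x l] through the other [x s]; substituting
    removes [l] from the expansion of [X]. *)
Lemma drop_generator (I : finType) (d e : nat) (X : 'M[R]_(e, d)) (x c : I -> R)
    (Y : I -> 'M[R]_(e, d)) (S : {set I}) l :
  X = \sum_(s in S) x s *: Y s -> l \in S -> c l \in GRing.unit ->
  \sum_(s in S) x s * c s = 0 ->
  exists Y', X = \sum_(s in S :\ l) x s *: Y' s.
Proof.
move=> XE lS cu; rewrite (big_setD1 l) //= => /eqP; rewrite addr_eq0 => /eqP cE.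
exists (fun s => Y s - (c s / c l) *: Y l).
rewrite XE (big_setD1 l) //= -[x l](mulrK cu) cE mulNr scaleNr.
under [RHS]eq_bigr do rewrite scalerBr scalerA mulrA.
by rewrite sumrB -scaler_suml -mulr_suml addrC.
Qed.

(** [X] is expanded along some of its own entries. While one entry remains, the entries in use
    satisfy a linear relation with a unit coefficient, which eliminates one of them; the empty
    expansion gives [X = 0]. *)
Lemma intertwiner_local_eq0 (G : Type) (d e : nat)
    (r : G -> 'M[R]_d) (r' : G -> 'M[R]_e) (X : 'M[R]_(e, d)) :
  (forall Y : 'M[K]_(e, d),
     (forall g, Y *m map_mx res (r g) = map_mx res (r' g) *m Y) -> Y = 0) ->
  (forall g, X *m r g = r' g *m X) -> X = 0.
Proof.
move=> hom0 Xint.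
(* Induction on the number of entries in use, starting from all positions with the elementary
   matrices as coefficients. *)
suff H m (S : {set 'I_e * 'I_d}) Y : #|S| = m ->
    X = \sum_(s in S) X s.1 s.2 *: Y s -> X = 0.
  apply: (H _ [set: _]%SET (fun s => delta_mx s.1 s.2)) => //.
  under eq_bigl do rewrite finset.in_setT.
  rewrite [LHS]matrix_sum_delta.
  by rewrite (pair_bigA _ (fun i j => X i j *: delta_mx i j)).
elim: m S Y => [|m IHm] S Y Sm XE.
  by rewrite XE (cards0_eq Sm) big_set0.
suff [l lS [c cu c0]] : exists2 l, l \in S & exists2 c : 'I_e * 'I_d -> R,
    c l \in GRing.unit & \sum_(s in S) X s.1 s.2 * c s = 0.
  have [Y' XE'] := drop_generator XE lS cu c0.
  by apply: IHm XE'; move: Sm; rewrite (cardsD1 l) lS => -[].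
(* If some [Y l] has nonzero reduction, that reduction is not an intertwiner, so for some [g], [a],
   [b] the [(a, b)] entry of [Y l *m r g - r' g *m Y l] is a unit. The same entry of
   [X *m r g - r' g *m X = 0] is the relation sought. *)
have [/existsP[l /andP[lS Yl]]|/existsPn Y0] :=
    boolP [exists l, (l \in S) && (map_mx res (Y l) != 0)].
  exists l => //.
  have /existsNP[g] : ~ forall g,
      map_mx res (Y l) *m map_mx res (r g) = map_mx res (r' g) *m map_mx res (Y l).
    by move=> /hom0 /eqP; rewrite (negPf Yl).
  rewrite -!map_mxM => /eqP; rewrite -subr_eq0 -map_mxB => /eqP/matrixP nz.
  have /existsNP[a /existsNP[b]] : ~ forall a b,
      map_mx res (Y l *m r g - r' g *m Y l) a b = 0.
    by move=> nz'; apply: nz => a b; rewrite nz' mxE.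
  rewrite mxE => /eqP nz'.
  exists (fun s => (Y s *m r g - r' g *m Y s) a b); first by rewrite -res_unitP.
  have rel : (X *m r g - r' g *m X) a b = 0 by rewrite Xint subrr mxE.
  rewrite XE mulmx_suml mulmx_sumr -sumrB summxE in rel.
  rewrite -[RHS]rel; apply: eq_bigr => s _.
  by rewrite -scalemxAl -scalemxAr -scalerBr [RHS]mxE.
(* Otherwise every [Y s] with [s] in [S] reduces to 0, and any [l] will do: the expansion of [X]
   read at position [l] is a relation in which [X l.1 l.2] has coefficient [1 - Y l l.1 l.2], of
   residue 1. *)
have [l lS] : exists l, l \in S by apply/card_gt0P; rewrite Sm.
exists l => //; exists (fun s => (s == l)%:R - Y s l.1 l.2).
  have /nandP[|/negPn/eqP/matrixP/(_ l.1 l.2)] := Y0 l; first by rewrite lS.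
  by rewrite -res_unitP !mxE rmorphB eqxx rmorph1 => ->; rewrite subr0 oner_eq0.
under eq_bigr do rewrite mulrBr.
rewrite sumrB (big_setD1 l) //= eqxx mulr1 big1 => [|s]; last first.
  by rewrite !inE => /andP[/negPf -> _]; rewrite mulr0.
rewrite addr0 {1}XE summxE; apply/eqP; rewrite subr_eq0; apply/eqP.
by apply: eq_bigr => s _; rewrite mxE.
Qed.

End LocalRing.

(** * Matrices under ring homomorphisms *)

Section MapMx.
Variables (R R' : comUnitRingType) (f : {rmorphism R -> R'}).

Lemma map_unitmx_rmorph m (M : 'M[R]_m) :
  M \in unitmx -> map_mx f M \in unitmx.
Proof. by rewrite !unitmxE det_map_mx => /(rmorph_unit f). Qed.

Lemma map_invmx_rmorph m (M : 'M[R]_m) :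
  M \in unitmx -> map_mx f (invmx M) = invmx (map_mx f M).
Proof.
by move=> uM; apply/esym/mulmx1_invmx; rewrite -map_mxM mulmxV // map_mx1.
Qed.

Lemma map_mx_surj : (forall b, exists a, f a = b) ->
  forall m n (M : 'M[R']_(m, n)), exists N, map_mx f N = M.
Proof.
move=> fs m n M; exists (\matrix_(i, j) sval (cid (fs (M i j)))).
by apply/matrixP => i j; rewrite !mxE; exact: svalP (cid (fs (M i j))).
Qed.

End MapMx.

(** * Powers of ideals and matrix products *)

Section Ideals.
Variable A : comNzRingType.
Implicit Types I J : set A.

Lemma is_ideal_sum I (T : finType) (x : T -> A) :
  is_ideal I -> (forall t, I (x t)) -> I (\sum_t x t).
Proof. by case=> I0 ID _ Ix; apply: (big_ind I). Qed.

Lemma ideal_exp_is_ideal I n : is_ideal I -> is_ideal (ideal_exp I n).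
Proof.
move=> [I0 ID IM]; split; first exact: ideal_exp0.
  case: n => [|n] // x y [r [a [b [Ia Ib ->]]]] [s [a' [b' [Ia' Ib' ->]]]].
  exists (r + s)%N, (fun i => match fintype.split i with inl i => a i | inr i => a' i end),
    (fun i => match fintype.split i with inl i => b i | inr i => b' i end).
  split=> [i|i|]; try by case: (fintype.split i).
  rewrite big_split_ord /=; congr (_ + _); apply: eq_bigr => i _.
    by rewrite -/(unsplit (inl i)) unsplitK.
  by rewrite -/(unsplit (inr i)) unsplitK.
case: n => [|n] // c x [r [a [b [Ia Ib ->]]]].
exists r, (fun i => c * a i), b; split=> // [i|]; first exact: IM.
by rewrite mulr_sumr; apply: eq_bigr => i _; rewrite mulrA.
Qed.

Lemma ideal_mulmx I m n p q (M : 'M[A]_(m, n)) (X : 'M[A]_(n, p))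
    (N : 'M[A]_(p, q)) : is_ideal I -> (forall i j, I (X i j)) ->
  forall i j, I ((M *m X *m N) i j).
Proof.
move=> II IX i j; have [_ _ IM] := II; rewrite mxE.
apply: is_ideal_sum => // l; rewrite mulrC; apply: (IM); rewrite mxE.
by apply: is_ideal_sum => // l1; apply: (IM).
Qed.

End Ideals.

(** * Conjugates, blocks and equivalence of representations over CNL algebras *)

Section Representations.
Variables (k : finFieldType) (ell : nat) (W : wittRing k ell).
Variables (F : fieldType) (Fbar : algClosure F).
Local Notation G := (Defs.gal Fbar).
Local Notation rep := (@rep k ell W F Fbar).

Lemma cnl_hom_unitP (A B : cnl W) (f : cnl_hom A B) a :
  f a \is a GRing.unit -> a \is a GRing.unit.
Proof. by apply: contraTT => /(cnl_hom_local f). Qed.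

(** Local homomorphisms reflect units, hence invertible determinants: any entrywise lift of an
    invertible matrix is itself invertible. *)
Lemma cnl_hom_unitmx (A B : cnl W) (f : cnl_hom A B) m (M : 'M[A]_m) :
  map_mx f M \in unitmx -> M \in unitmx.
Proof. by rewrite !unitmxE det_map_mx => /cnl_hom_unitP. Qed.

Definition cnl_id (A : cnl W) : cnl_hom A A :=
  @CnlHom _ _ _ A A idfun (fun w => erefl) (fun a am => am).

Lemma rep_unitmx (A : cnl W) d (r : rep A d) g : r g \in unitmx.
Proof.
have /mulmx1_unit[] // : r g *m r (g^-1)%g = 1%:M.
by rewrite -repM mulgV rep1.
Qed.

(** Continuity survives because powers of the maximal ideal are ideals, hence stable under the
    linear combinations that form the entries of [M *m (r h - r g) *m invmx M]. *)
Lemma conj_rep (A : cnl W) d (r : rep A d) (M : 'M[A]_d) : M \in unitmx ->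
  exists r' : rep A d, forall g, r' g = M *m r g *m invmx M.
Proof.
move=> uM; pose s g := M *m r g *m invmx M.
have s1 : s 1%g = 1%:M by rewrite /s rep1 mulmx1 mulmxV.
have sM g h : s (g * h)%g = s g *m s h by rewrite /s repM !mulmxA mulmxKV.
suff sc g m : krull_nbhs g
    [set h | forall i j, ideal_exp (@max_ideal A) m (s h i j - s g i j)].
  by exists (Rep s1 sM sc).
apply: krull_nbhsS (rep_continuous r g m) => h hg i j.
have -> : s h i j - s g i j = (M *m (r h - r g) *m invmx M) i j.
  by rewrite mulmxBr mulmxBl; apply: esym; rewrite mxE; congr (_ + _); rewrite mxE.
apply: ideal_mulmx; first exact/ideal_exp_is_ideal/cnl_local.
by move=> a b; have := hg a b; rewrite !mxE.
Qed.

Lemma block_rep (A : cnl W) n (d : 'I_n -> nat) (r : rep A (\sum_i d i)) :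
  (forall g i j, i != j -> submxblock (r g) i j = 0) ->
  exists rs : forall i, rep A (d i), forall g, r g = \mxdiag_i rs i g.
Proof.
move=> r0; have rE g := mxdiag_submxblock (r0 g).
suff rs i : exists s : rep A (d i), forall g, s g = submxblock (r g) i i.
  exists (fun i => sval (cid (rs i))) => g; rewrite [LHS]rE.
  by apply: eq_mxdiag => i; rewrite (svalP (cid (rs i))).
pose s g := submxblock (r g) i i.
have s1 : s 1%g = 1%:M by rewrite /s rep1 -mxdiagZ submxblock_diag.
have sM g h : s (g * h)%g = s g *m s h.
  by rewrite /s repM {1}(rE g) submxblock_mul_mxdiagl.
suff sc g m : krull_nbhs g
    [set h | forall i j, ideal_exp (@max_ideal A) m (s h i j - s g i j)].
  by exists (Rep s1 sM sc).
apply: krull_nbhsS (rep_continuous r g m) => h hg a b.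
by rewrite !mxE; apply: hg.
Qed.

Lemma equivalent_sym (R : comUnitRingType) d (r r' : G -> 'M[R]_d) :
  equivalent r r' -> equivalent r' r.
Proof.
move=> [M uM rE]; exists (invmx M); first by rewrite unitmx_inv.
by move=> g; exact: conj_unitmx_sym (rE g).
Qed.

Lemma equivalent_trans (R : comUnitRingType) d (r s t : G -> 'M[R]_d) :
  equivalent r s -> equivalent s t -> equivalent r t.
Proof.
move=> [M uM rE] [N uN sE]; exists (M *m N); first by rewrite unitmx_mul uM.
move=> g; apply/conj_unitmxP; first by rewrite unitmx_mul uM.
by rewrite rE sE !mulmxA mulmxKV // mulmxKV.
Qed.

Lemma equivalent_map (R R' : comUnitRingType) (f : {rmorphism R -> R'}) d
    (r r' : G -> 'M[R]_d) :
  equivalent r r' -> equivalent (fun g => map_mx f (r g)) (fun g => map_mx f (r' g)).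
Proof.
move=> [M uM rE]; exists (map_mx f M); first exact: map_unitmx_rmorph.
by move=> g; rewrite rE !map_mxM map_invmx_rmorph.
Qed.

Lemma equivalent_mxdiag (R : comUnitRingType) n (d : 'I_n -> nat)
    (r r' : forall i, G -> 'M[R]_(d i)) :
  (forall i, equivalent (r i) (r' i)) ->
  equivalent (fun g => \mxdiag_i r i g) (fun g => \mxdiag_i r' i g).
Proof.
move=> rr'; have /all_sig2[M uM rE] : forall i, {M | M \in unitmx &
    forall g, r i g = M *m r' i g *m invmx M}.
  by move=> i; apply: cid2; exact: rr'.
exists (\mxdiag_i M i); first exact/mxdiag_unitmx.
move=> g; rewrite invmx_mxdiag // !mul_mxdiag.
by apply: eq_mxdiag => i; rewrite rE.
Qed.

Lemma eq_equivalent (R : comUnitRingType) d (r r' : G -> 'M[R]_d) :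
  (forall g, r g = r' g) -> equivalent r r'.
Proof.
move=> rr'; exists 1%:M; first exact: unitmx1.
by move=> g; rewrite rr' invmx1 mulmx1 mul1mx.
Qed.

Section DeformationCondition.
Variables (d : nat) (rhobar : rep (k_cnl W) d) (D : rep_subcat W Fbar d).
Hypothesis D_def : deformation_condition rhobar D.

(** This is (DC1) along the identity of [A]. *)
Lemma dc_equivalent (A : cnl W) (r r' : rep A d) :
  equivalent r r' -> D r -> D r'.
Proof.
move=> [M uM rE]; apply: (dc1 D_def (f := cnl_id A) uM) => g.
by rewrite map_mx_id // rE.
Qed.

Lemma dc_map (A B : cnl W) (f : cnl_hom A B) (r : rep A d) :
  D r -> D (rep_map f r).
Proof.
apply: (dc1 D_def (f := f) (unitmx1 _ _)) => g.
by rewrite invmx1 mulmx1 mul1mx.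
Qed.

End DeformationCondition.

(** * Direct sums: deformation condition and smoothness *)

Section Sum.
Variables (n : nat) (d : 'I_n -> nat) (rhobar : forall i, rep (k_cnl W) (d i)).
Hypothesis hom0 : forall i j, i <> j -> forall X : 'M[k]_(d j, d i),
  intertwiner (rhobar i) (rhobar j) X -> X = 0.

Definition lifts (A : cnl W) (r : forall i, rep A (d i)) :=
  forall i, @equivalent F Fbar k (d i) (fun g => map_mx (cnl_res A) (r i g)) (rhobar i).

(** The [(i, j)] block of [M] intertwines [r j] with [r' i], so for distinct [i] and [j] the local
    vanishing lemma applies to it. *)
Lemma mxdiag_intertwiner (A : cnl W) (r r' : forall i, rep A (d i))
    (M : 'M[A]_(\sum_i d i)) : lifts r -> lifts r' ->
  (forall g, M *m (\mxdiag_i r i g) = (\mxdiag_i r' i g) *m M) ->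
  M = \mxdiag_i submxblock M i i.
Proof.
move=> lr lr' Mint; apply: mxdiag_submxblock => i j /eqP ij.
apply: (intertwiner_local_eq0 (@cnl_res_ker _ _ _ A) (r := r j) (r' := r' i)).
  move=> Y Yint; have [P uP rE] := lr j; have [Q uQ rE'] := lr' i.
  (* The reductions are only equivalent to [rhobar j] and [rhobar i]; [P] and [Q] transport [Y] to
     an intertwiner between these. *)
  have : invmx Q *m Y *m P = 0.
    apply: (hom0 (nesym ij)) => g; move: (Yint g); rewrite rE rE' => /(congr1
      (fun X => invmx Q *m X *m P)).
    by rewrite !mulmxA mulmxKV // mulVmx // mul1mx.
  move=> /(congr1 (fun X => Q *m X *m invmx P)).
  by rewrite !mulmxA mulmxV // mul1mx mulmxK // mulmx0 mul0mx.
move=> g; have /(congr1 (fun X => submxblock X i j)) := Mint g.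
by rewrite submxblock_mul_mxdiagl submxblock_mul_mxdiagr.
Qed.

Variable D : forall i, rep_subcat W Fbar (d i).
Hypothesis D_def : forall i, deformation_condition (rhobar i) (@D i).

Lemma lifts_D (A : cnl W) (r : forall i, rep A (d i)) :
  (forall i, D (r i)) -> lifts r.
Proof. by move=> Dr i; exact: (dc0_res (D_def i) (Dr i)). Qed.

Lemma dsum_dc1 (A B : cnl W) (f : cnl_hom A B) (M : 'M[B]_(\sum_i d i))
    (r : rep A (\sum_i d i)) (r' : rep B (\sum_i d i)) :
  M \in unitmx -> (forall g, map_mx f (r g) = M *m r' g *m invmx M) ->
  dsum_subcat D r -> dsum_subcat D r'.
Proof.
move=> uM rE [rs Drs ers].
exists (fun i => rep_map f (rs i)) => [i|]; first exact: (dc_map (D_def i)).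
have : equivalent r' (fun g => map_mx f (r g)) by apply: equivalent_sym; exists M.
move=> /equivalent_trans; apply.
apply: equivalent_trans (equivalent_map f ers) _.
by apply: eq_equivalent => g /=; rewrite map_mxdiag ?rmorph0.
Qed.

(** The substance is the descent from [A] and [B] to [E]: the two changes of basis are made to agree
    over [C], glued over [E], and (DC2) is then applied to each summand. *)
Lemma dsum_dc2 (A B C E : cnl W) (alpha : cnl_hom A C) (beta : cnl_hom B C)
    (pA : cnl_hom E A) (pB : cnl_hom E B) :
  artinian A -> artinian B -> artinian C -> small beta ->
  is_fibre_product alpha beta pA pB ->
  forall r : rep E (\sum_i d i), dsum_subcat D r <->
    dsum_subcat D (rep_map pA r) /\ dsum_subcat D (rep_map pB r).
Proof.
move=> artA artB artC smb fib r; split=> [Dr|].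
  by split; [apply: (dsum_dc1 (f := pA) (unitmx1 _ _)) Dr
            |apply: (dsum_dc1 (f := pB) (unitmx1 _ _)) Dr] => g;
    rewrite invmx1 mulmx1 mul1mx.
have [pE pEx] := fib; have [bs _] := smb.
move=> [[ra Dra [MA uMA raE]] [rb Drb [MB uMB rbE]]].
have DaC i := dc_map (D_def i) alpha (Dra i).
have DbC i := dc_map (D_def i) beta (Drb i).
have uaMA := map_unitmx_rmorph alpha uMA.
have ubMB := map_unitmx_rmorph beta uMB.
(* [Q] compares over [C] the decomposition coming from [A] with the one coming from [B]. *)
pose Q := invmx (map_mx beta MB) *m map_mx alpha MA.
have uQ : Q \in unitmx by rewrite unitmx_mul unitmx_inv ubMB.
have QE : Q = \mxdiag_i submxblock Q i i.
  apply: mxdiag_intertwiner (lifts_D DaC) (lifts_D DbC) _ => g /=.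
  rewrite -!map_mxdiag ?rmorph0 //.
  have /(congr1 (map_mx alpha)) := (conj_unitmxP _ _ uMA).1 (raE g).
  have /(congr1 (map_mx beta)) := (conj_unitmxP _ _ uMB).1 (rbE g).
  rewrite !map_mxM /= => eB eA.
  have ab : map_mx alpha (map_mx pA (r g)) = map_mx beta (map_mx pB (r g)).
    by apply/matrixP => i j; rewrite !mxE pE.
  rewrite /Q -mulmxA -eA ab.
  apply: (can_inj (mulKmx ubMB)); rewrite !mulmxA -eB mulmxV // mul1mx.
  by rewrite mulmxK.
have uq i : submxblock Q i i \in unitmx by move: i; apply/mxdiag_unitmx; rewrite -QE.
have /all_sig[q' q'E] : forall i, {N | map_mx beta N = submxblock Q i i}.
  by move=> i; apply: cid; exact: map_mx_surj.
have uq' i : q' i \in unitmx by apply: (@cnl_hom_unitmx _ _ beta); rewrite q'E.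
(* Correcting [MB] by the lifted blocks of [Q] makes it agree with [MA] over [C]; the summands over
   [B] are conjugated by the [q' i] to compensate. *)
pose MB' := MB *m \mxdiag_i q' i.
have uMB' : MB' \in unitmx by rewrite unitmx_mul uMB; exact/mxdiag_unitmx.
have MAB : map_mx alpha MA = map_mx beta MB'.
  rewrite map_mxM map_mxdiag ?rmorph0 //; under eq_mxdiag do rewrite q'E.
  by rewrite -QE mulKVmx.
have /all_sig[rb' rb'E] : forall i, {s : rep B (d i) |
    forall g, s g = invmx (q' i) *m rb i g *m invmx (invmx (q' i))}.
  by move=> i; apply: cid; apply: conj_rep; rewrite unitmx_inv.
have Drb' i : D (rb' i).
  apply: (dc_equivalent (D_def i) _ (Drb i)); apply: equivalent_sym.
  by exists (invmx (q' i)) => //; rewrite unitmx_inv.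
have rb'B g : map_mx pB (r g) = MB' *m (\mxdiag_i rb' i g) *m invmx MB'.
  apply/conj_unitmxP => //; rewrite /MB' mulmxA.
  have /= -> := (conj_unitmxP _ _ uMB).1 (rbE g); rewrite -!mulmxA; congr (_ *m _).
  rewrite !mul_mxdiag; apply: eq_mxdiag => i.
  by rewrite rb'E invmxK !mulmxA mulmxV // mul1mx.
(* Made total by the default value 0 off the fibre product; [MAB] ensures that the default is never
   met in [ME]. *)
clearbody MB'; have glue a b : {x | alpha a = beta b -> pA x = a /\ pB x = b}.
  apply: cid; have [/pEx[x [xP _]]|ne] := pselect (alpha a = beta b).
    by exists x.
  by exists 0.
pose ME : 'M[E]_(\sum_i d i) := \matrix_(i, j) sval (glue (MA i j) (MB' i j)).
have MEP i j : pA (ME i j) = MA i j /\ pB (ME i j) = MB' i j.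
  rewrite mxE; apply: (svalP (glue (MA i j) (MB' i j))).
  by have /matrixP/(_ i j) := MAB; rewrite !mxE.
have MEA : map_mx pA ME = MA by apply/matrixP => i j; rewrite mxE; case: (MEP i j).
have MEB : map_mx pB ME = MB' by apply/matrixP => i j; rewrite mxE; case: (MEP i j).
have uME : ME \in unitmx by apply: (@cnl_hom_unitmx _ _ pA); rewrite MEA.
have [r' r'E] : exists r' : rep E _, forall g, r' g = invmx ME *m r g *m invmx (invmx ME).
  by apply: conj_rep; rewrite unitmx_inv.
have r'A g : map_mx pA (r' g) = \mxdiag_i ra i g.
  rewrite r'E invmxK !map_mxM map_invmx_rmorph // MEA.
  by rewrite [map_mx pA _]raE !mulmxA mulVmx // mul1mx mulmxKV.
have r'B g : map_mx pB (r' g) = \mxdiag_i rb' i g.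
  rewrite r'E invmxK !map_mxM map_invmx_rmorph // MEB.
  by rewrite [map_mx pB _]rb'B !mulmxA mulVmx // mul1mx mulmxKV.
(* Both [x] and 0 lie above the pair [(0, 0)], so uniqueness in the fibre product identifies them.
   The off-diagonal blocks of [r'] then vanish, as they do under both projections. *)
have inj0 x : pA x = 0 -> pB x = 0 -> x = 0.
  move=> xA xB; have [|y [_ yU]] := pEx 0 0; first by rewrite !rmorph0.
  by rewrite -(yU x) ?(yU 0) // !rmorph0.
have [|re reE] := @block_rep E n d r'.
  move=> g i j ij; apply/matrixP => a b; rewrite [RHS]mxE; apply: inj0.
    have := congr1 (fun X => submxblock X i j) (r'A g).
    by rewrite submxblock_mxdiag_neq // submxblock_map => /matrixP/(_ a b); rewrite !mxE.
  have := congr1 (fun X => submxblock X i j) (r'B g).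
  by rewrite submxblock_mxdiag_neq // submxblock_map => /matrixP/(_ a b); rewrite !mxE.
exists re => [i|]; last first.
  exists ME => // g /=; rewrite -reE r'E.
  by rewrite invmxK !mulmxA mulmxV // mul1mx mulmxK.
apply/(dc2 (D_def i) artA artB artC smb fib); split.
  apply: (dc_equivalent (D_def i) _ (Dra i)); apply: eq_equivalent => g /=.
  by move: i; apply: mxdiag_inj; rewrite -r'A reE map_mxdiag ?rmorph0.
apply: (dc_equivalent (D_def i) _ (Drb' i)); apply: eq_equivalent => g /=.
by move: i; apply: mxdiag_inj; rewrite -r'B reE map_mxdiag ?rmorph0.
Qed.

Lemma dsum_deformation_condition :
  deformation_condition (rep_dsum rhobar) (dsum_subcat D).
Proof.
split.
- exists rhobar => [i|]; first exact: (dc0 (D_def i)).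
  by apply: eq_equivalent.
- move=> A r [rs Drs ers]; apply: equivalent_trans (equivalent_map _ ers) _.
  have := equivalent_mxdiag (lifts_D Drs).
  apply: equivalent_trans; apply: eq_equivalent => g /=.
  by rewrite map_mxdiag ?rmorph0.
- exact: dsum_dc1.
- exact: dsum_dc2.
Qed.

Lemma dsum_smooth : (forall i, smooth (@D i)) -> smooth (dsum_subcat D).
Proof.
move=> sD A B f fs r [rs Drs [M uM rE]].
have /all_sig2[rs' Drs' rsE] : forall i, {s : rep A (d i) | D s &
    forall g, map_mx f (s g) = rs i g}.
  by move=> i; apply: cid2; exact: sD (Drs i).
(* The lift [N] of the change of basis is invertible because [f] is local. *)
have [N NM] := map_mx_surj fs M.
have uN : N \in unitmx by apply: (@cnl_hom_unitmx _ _ f); rewrite NM.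
have [r' r'E] := conj_rep (rep_dsum rs') uN.
exists r'; first by exists rs' => //; exists N.
move=> g; rewrite r'E !map_mxM map_invmx_rmorph // NM rE /= map_mxdiag ?rmorph0 //.
by congr (_ *m _ *m _); apply: eq_mxdiag => i.
Qed.

End Sum.
End Representations.

(** * Dimensions of direct sums of subspaces *)

Section Dimension.
Variable K : fieldType.

(** Allows a basis indexed by any finite type, in particular by the pairs (summand, basis vector) of
    a direct sum. *)
Lemma has_dim_card (V : lmodType K) (S : set V) (T : finType) (e : T -> V) :
  (forall c : T -> K, \sum_t c t *: e t = 0 -> forall t, c t = 0) ->
  S = [set v | exists c : T -> K, v = \sum_t c t *: e t] -> has_dim S #|T|.
Proof.
move=> free SE; exists (e \o enum_val).
have sumE (c : 'I_#|T| -> K) :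
    \sum_i c i *: (e \o enum_val) i = \sum_t c (enum_rank t) *: e t.
  rewrite (reindex (@enum_rank T)) /=; last exact/onW_bij/enum_rank_bij.
  by apply: eq_bigr => t _; rewrite enum_rankK.
split=> [c|].
  by rewrite sumE => /free c0 i; rewrite -[i]enum_valK c0.
rewrite SE; apply/seteqP; split=> v [c ->].
  exists (c \o enum_val); rewrite sumE.
  by apply: eq_bigr => t _ /=; rewrite enum_rankK.
by exists (c \o enum_rank); rewrite sumE.
Qed.

(** Stated for an arbitrary linear [Psi] so as to serve both tangent spaces and invariants. The
    basis of [S'] consists of the images of the basis vectors of the [S i] extended by zero. *)
Lemma has_dim_dsum n (V : 'I_n -> lmodType K) (V' : lmodType K)
    (S : forall i, set (V i)) (S' : set V') (m : 'I_n -> nat)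
    (Psi : (forall i, V i) -> V') :
  (forall a x y, Psi (fun i => a *: x i + y i) = a *: Psi x + Psi y) ->
  set_bij [set x | forall i, S i (x i)] S' Psi ->
  (forall i, has_dim (S i) (m i)) -> has_dim S' (\sum_i m i).
Proof.
move=> lin [sub inj surj] dimS.
have Psi0 : Psi (fun=> 0) = 0.
  (* With [a = -1] and [x = y] the right-hand side of [lin] cancels. *)
  have := lin (-1) (fun=> 0) (fun=> 0); rewrite scaleN1r addNr => <-.
  by congr Psi; apply: functional_extensionality_dep => i; rewrite scaler0 addr0.
have Psi_sum (T : finType) (c : T -> K) (x : T -> forall i, V i) :
    Psi (fun i => \sum_t c t *: x t i) = \sum_t c t *: Psi (x t).
  elim: (index_enum T) => [|t s IHs].
    by rewrite big_nil -[RHS]Psi0; congr Psi; apply: functional_extensionality_dep => i; rewrite big_nil.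
  rewrite big_cons -IHs -lin; congr Psi.
  by apply: functional_extensionality_dep => i; rewrite big_cons.
have /all_sig[e eP] i := cid (dimS i).
pose Tg i (j : 'I_(m i)) : {i & 'I_(m i)} := Tagged (fun i => 'I_(m i)) j.
pose b (t : {i & 'I_(m i)}) : forall i, V i :=
  dfwith (fun i => 0 : V i) (e (tag t) (tagged t)).
have combE (c : {i & 'I_(m i)} -> K) :
    \sum_t c t *: Psi (b t) =
    Psi (fun i => \sum_j c (Tg i j) *: e i j).
  rewrite -Psi_sum; congr Psi; apply: functional_extensionality_dep => i.
  (* The sum over pairs is regrouped by summand; only the vectors of summand [i] have a nonzero
     [i]-th coordinate. *)
  transitivity (\sum_i' \sum_(j < m i') c (Tg i' j) *: b (Tg i' j) i).
    by rewrite sig_big_dep; apply: eq_bigr => -[].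
  rewrite (bigD1 i) //= [X in _ + X]big1 ?addr0 => [|i' ne].
    by apply: eq_bigr => j _; rewrite /b dfwith_in.
  by apply: big1 => j _; rewrite /b dfwith_out ?scaler0.
have inS (c : {i & 'I_(m i)} -> K) i : S i (\sum_j c (Tg i j) *: e i j).
  by rewrite (eP i).2; exists (fun j => c (Tg i j)).
have -> : (\sum_i m i)%N = #|{: {i & 'I_(m i)}}|.
  by rewrite card_tagged sumnE big_map big_enum; under [RHS]eq_bigr do rewrite card_ord.
apply: (@has_dim_card _ _ _ (Psi \o b)) => [c|].
  rewrite combE -Psi0 => /inj H [i j].
  apply: ((eP i).1 (fun j => c (Tg i j))).
  have S0 : (fun i => 0 : V i) \in [set x | forall i, S i (x i)].
    rewrite inE /= => i'; rewrite (eP i').2; exists (fun=> 0).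
    by rewrite big1 // => l _; rewrite scale0r.
  have Sc : (fun i => \sum_j c (Tg i j) *: e i j) \in [set x | forall i, S i (x i)].
    by rewrite inE /=; exact: inS.
  exact: (congr1 (fun f => f i) (H Sc S0)).
apply/seteqP; split=> [v /surj[x Sx <-]|v [c ->]]; last first.
  by rewrite combE; apply: sub.
have /all_sig[c cE] : forall i, {c : 'I_(m i) -> K | x i = \sum_j c j *: e i j}.
  by move=> i; apply: cid; have := Sx i; rewrite {1}(eP i).2.
exists (fun t => c (tag t) (tagged t)); rewrite combE; congr Psi.
by apply: functional_extensionality_dep => i.
Qed.

End Dimension.

(** * Coordinates on matrices over the dual numbers *)

Section Dual.
Variable k : finFieldType.
Implicit Types a b : dual k.

(** The coefficient of epsilon: together with [dual_res] it determines a dual number, and it is a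
    derivation over [dual_res]. *)
Definition dual_im a : k := (a : {poly k})`_1.

Lemma dual_imB : zmod_morphism dual_im.
Proof. by move=> a b; rewrite /dual_im /= coefB. Qed.

HB.instance Definition _ := GRing.isZmodMorphism.Build (dual k) k dual_im dual_imB.

Lemma dual_imM a b :
  dual_im (a * b) = dual_res a * dual_im b + dual_im a * dual_res b.
Proof.
by rewrite /dual_im dual_coefM // coefM !big_ord_recl big_ord0 addr0.
Qed.

Lemma dual_imC x : dual_im (dual_const k x) = 0.
Proof. exact: (coefC x 1%N). Qed.

Lemma dual_epsE : dual_eps k = 'X :> {poly k}.
Proof. by apply: qpolyXE; rewrite ?size_polyXn ?monicXn. Qed.

Lemma dual_res_eps : dual_res (dual_eps k) = 0.
Proof. by rewrite /dual_res dual_epsE coefX. Qed.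

Lemma dual_im_eps : dual_im (dual_eps k) = 1.
Proof. by rewrite /dual_im dual_epsE coefX. Qed.

Lemma dual_eqP a b : dual_res a = dual_res b -> dual_im a = dual_im b -> a = b.
Proof.
move=> ab ab'; apply/eqP; rewrite -subr_eq0; apply/eqP; apply: dual_eq0.
  by rewrite -/(dual_res _) rmorphB /= ab subrr.
by rewrite -/(dual_im _) raddfB /= ab' subrr.
Qed.

Section Matrices.
Variables m n : nat.
Implicit Types M N : 'M[dual k]_(m, n).

Lemma dual_mxP M N : map_mx (@dual_res k) M = map_mx (@dual_res k) N ->
  map_mx dual_im M = map_mx dual_im N -> M = N.
Proof.
move=> /matrixP rMN /matrixP iMN; apply/matrixP => i j.
by apply: dual_eqP; [move: (rMN i j)|move: (iMN i j)]; rewrite !mxE.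
Qed.

Lemma map_dual_resC (X : 'M[k]_(m, n)) :
  map_mx (@dual_res k) (map_mx (dual_const k) X) = X.
Proof. by apply/matrixP => i j; rewrite !mxE dual_resC. Qed.

Lemma map_dual_imC (X : 'M[k]_(m, n)) :
  map_mx dual_im (map_mx (dual_const k) X) = 0.
Proof. by apply/matrixP => i j; rewrite !mxE dual_imC. Qed.

Lemma map_dual_imD M N :
  map_mx dual_im (M + N) = map_mx dual_im M + map_mx dual_im N.
Proof. by apply/matrixP => i j; rewrite !mxE raddfD. Qed.

Lemma map_dual_resZeps M : map_mx (@dual_res k) (dual_eps k *: M) = 0.
Proof. by apply/matrixP => i j; rewrite !mxE rmorphM /= dual_res_eps mul0r. Qed.

Lemma map_dual_imZeps M :
  map_mx dual_im (dual_eps k *: M) = map_mx (@dual_res k) M.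
Proof.
by apply/matrixP => i j; rewrite !mxE dual_imM dual_res_eps dual_im_eps mul0r mul1r add0r.
Qed.

End Matrices.

Lemma map_dual_imM m n p (M : 'M[dual k]_(m, n)) (N : 'M[dual k]_(n, p)) :
  map_mx dual_im (M *m N) =
  map_mx (@dual_res k) M *m map_mx dual_im N +
  map_mx dual_im M *m map_mx (@dual_res k) N.
Proof.
apply/matrixP => i j; rewrite !mxE raddf_sum -big_split; apply: eq_bigr => l _.
by rewrite /= dual_imM !mxE.
Qed.

(** Turns the shape [(1 + eps Z) X] into two equations over [k], the form in which cocycles are read
    off and rebuilt. *)
Lemma first_order_mxP m (M : 'M[dual k]_m) (Z X : 'M[k]_m) :
  M = (1%:M + dual_eps k *: map_mx (dual_const k) Z) *m map_mx (dual_const k) X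
  <-> map_mx (@dual_res k) M = X /\ map_mx dual_im M = Z *m X.
Proof.
set N := RHS.
have rN : map_mx (@dual_res k) N = X.
  rewrite /N map_mxM map_mxD map_mx1 map_dual_resZeps addr0.
  by rewrite map_dual_resC mul1mx.
have iN : map_mx dual_im N = Z *m X.
  rewrite /N map_dual_imM map_dual_imC mulmx0 add0r map_dual_imD.
  rewrite map_dual_imZeps !map_dual_resC.
  have -> : map_mx dual_im (1%:M : 'M[dual k]_m) = 0.
    by rewrite -(map_mx1 (dual_const k)) map_dual_imC.
  by rewrite add0r.
by split=> [->|[rM iM]] //; apply: dual_mxP; rewrite ?rM ?iM.
Qed.

End Dual.

(** * Cocycles, tangent spaces and invariants of a direct sum *)

Section Tangent.
Variables (k : finFieldType) (ell : nat) (W : wittRing k ell).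
Variables (F : fieldType) (Fbar : algClosure F).
Local Notation G := (Defs.gal Fbar).
Local Notation rep := (@rep k ell W F Fbar).

Lemma rep_k_locally_constant d (r : rep (k_cnl W) d) (g : G) :
  krull_nbhs g [set h | r h = r g].
Proof.
(* The first power suffices, since the maximal ideal of [k] is zero. *)
apply: krull_nbhsS (rep_continuous r g 1) => h hg; apply/matrixP => i j.
apply/eqP; rewrite -subr_eq0; apply/eqP.
have [s [a [b [am _ ->]]]] := hg i j; apply: big1 => l _.
by have /field_max_ideal -> := am l; rewrite mul0r.
Qed.

Lemma coboundaryP d (r : rep (k_cnl W) d) (X : 'M[k]_d) :
  (fun g => ad_act r g X - X) \in cocycle_pred r.
Proof.
apply/asboolP; split=> [g|g h].
  apply: krull_nbhsS (rep_k_locally_constant r g) => h /= hg.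
  by rewrite /ad_act hg.
have rM : ad_act r (g * h)%g X = ad_act r g (ad_act r h X).
  have ug : (r g : 'M[k]_d) \in unitmx := rep_unitmx r g.
  have uh : (r h : 'M[k]_d) \in unitmx := rep_unitmx r h.
  have ugh : (r (g * h)%g : 'M[k]_d) \in unitmx := rep_unitmx r (g * h)%g.
  apply/esym/(conj_unitmxP _ _ ugh).
  by rewrite /ad_act repM !mulmxA mulmxKV // mulmxKV.
by rewrite rM raddfB [RHS]addrC subrKA.
Qed.

Variables (n : nat) (d : 'I_n -> nat) (rhobar : forall i, rep (k_cnl W) (d i)).
Local Notation rho := (rep_dsum rhobar).

Lemma rho_unitmx i g : (rhobar i g : 'M[k]_(d i)) \in unitmx.
Proof. exact: (rep_unitmx (rhobar i) g). Qed.

Lemma submxblock_ad_act g (X : 'M[k]_(\sum_i d i)) i j :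
  submxblock (ad_act rho g X) i j =
  rhobar i g *m submxblock X i j *m invmx (rhobar j g : 'M[k]_(d j)).
Proof.
rewrite /ad_act /= (invmx_mxdiag (fun i => rho_unitmx i g)).
by rewrite submxblock_mul_mxdiagr submxblock_mul_mxdiagl.
Qed.

Lemma ad_act_mxdiag g (X : forall i, 'M[k]_(d i)) :
  ad_act rho g (\mxdiag_i X i) = \mxdiag_i ad_act (rhobar i) g (X i).
Proof.
rewrite /ad_act /= (invmx_mxdiag (fun i => rho_unitmx i g)).
by rewrite !mul_mxdiag.
Qed.

Lemma mxdiag_cocycleP (z : forall i, cocycle (rhobar i)) :
  (fun g => \mxdiag_i z i g) \in cocycle_pred rho.
Proof.
have zP i := asboolW (cocycleP (z i)).
apply/asboolP; split=> [g|g h].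
  have := krull_nbhs_forall (fun i => (zP i).1 g).
  by apply: krull_nbhsS => h /= hg; apply: eq_mxdiag.
rewrite ad_act_mxdiag -mxdiagD; apply: eq_mxdiag => i.
exact: (zP i).2.
Qed.

Definition cocycle_dsum z : cocycle rho := Cocycle (mxdiag_cocycleP z).

Lemma cocycle_block (z : cocycle rho) :
  (forall g i j, i != j -> submxblock (z g) i j = 0) ->
  exists zs, z = cocycle_dsum zs.
Proof.
move=> z0; have zE g := mxdiag_submxblock (z0 g).
have [zc zM] := asboolW (cocycleP z).
have zsP i : (fun g => submxblock (z g) i i) \in cocycle_pred (rhobar i).
  apply/asboolP; split=> [g|g h].
    by apply: krull_nbhsS (zc g) => h /= ->.
  by rewrite zM submxblockD submxblock_ad_act.
exists (fun i => Cocycle (zsP i)); apply: val_inj; apply/funext => g /=.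
exact: zE.
Qed.

(** Built on chosen cocycles; [H1_dsum_class] shows that any other representatives give the same
    class. *)
Definition H1_dsum (c : forall i, H1ad (rhobar i)) : H1ad rho :=
  H1_class (cocycle_dsum (fun i => sval (cid (H1_class_surj (c i))))).

(** Conjugation by [rho g] acts block by block, so the diagonal blocks of a matrix [X] bounding the
    sum bound the summands. One direction makes [H1_dsum] well defined, the other makes it
    injective. *)
Lemma eq_H1_dsum (z z' : forall i, cocycle (rhobar i)) :
  (H1_class (cocycle_dsum z) = H1_class (cocycle_dsum z')) <->
  (forall i, H1_class (z i) = H1_class (z' i)).
Proof.
split=> [/H1_classP[X zX] i|zz'].
  apply/H1_classP; exists (submxblock X i i) => g.
  have zXg : \mxdiag_i z i g - \mxdiag_i z' i g = ad_act rho g X - X := zX g.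
  have := congr1 (fun M => submxblock M i i) zXg.
  by rewrite !submxblockB !submxblock_diag submxblock_ad_act.
have /all_sig[X XE] : forall i, {X | forall g, (z i - z' i) g = ad_act (rhobar i) g X - X}.
  by move=> i; apply: cid; apply/H1_classP.
apply/H1_classP; exists (\mxdiag_i X i) => g; rewrite ad_act_mxdiag -mxdiagB.
transitivity (\mxdiag_i z i g - \mxdiag_i z' i g) => //.
by rewrite -mxdiagB; apply: eq_mxdiag => i; rewrite -XE.
Qed.

Lemma H1_dsum_class (z : forall i, cocycle (rhobar i)) :
  H1_dsum (fun i => H1_class (z i)) = H1_class (cocycle_dsum z).
Proof.
by apply/eq_H1_dsum => i; exact: svalP (cid (H1_class_surj (H1_class (z i)))).
Qed.

Lemma H1ad_family_surj (c : forall i, H1ad (rhobar i)) :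
  exists z : forall i, cocycle (rhobar i), c = fun i => H1_class (z i).
Proof.
exists (fun i => sval (cid (H1_class_surj (c i)))).
apply: functional_extensionality_dep => i.
by rewrite (svalP (cid (H1_class_surj (c i)))).
Qed.

Lemma H1_dsum_linear a (x y : forall i, H1ad (rhobar i)) :
  H1_dsum (fun i => a *: x i + y i) = a *: H1_dsum x + H1_dsum y.
Proof.
have [z ->] := H1ad_family_surj x; have [w ->] := H1ad_family_surj y.
have -> : (fun i => a *: (H1_class (z i) : H1ad _) + H1_class (w i)) =
          (fun i => H1_class (a *: z i + w i) : H1ad (rhobar i)).
  apply: functional_extensionality_dep => i.
  by rewrite H1_classD H1_classZ.
rewrite !H1_dsum_class.
have -> : cocycle_dsum (fun i => a *: z i + w i) = a *: cocycle_dsum z + cocycle_dsum w.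
  apply: val_inj; apply/funext => g.
  transitivity (a *: (\mxdiag_i z i g) + \mxdiag_i w i g); last by [].
  by rewrite scale_mxdiag -mxdiagD.
by rewrite H1_classD H1_classZ.
Qed.

Lemma H1_dsum_inj (x y : forall i, H1ad (rhobar i)) : H1_dsum x = H1_dsum y -> x = y.
Proof.
have [z ->] := H1ad_family_surj x; have [w ->] := H1ad_family_surj y.
rewrite !H1_dsum_class => /eq_H1_dsum zw.
exact: functional_extensionality_dep.
Qed.

Lemma first_order_dsum (r : forall i, rep (dual_cnl W) (d i)) c :
  (forall i, first_order (r i) (c i)) -> first_order (rep_dsum r) (H1_dsum c).
Proof.
move=> /(_ _)/cid2 fo; have /all_sig2[z zc rE] := fo.
have -> : c = fun i => H1_class (z i).
  by apply: functional_extensionality_dep => i; rewrite zc.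
rewrite H1_dsum_class; exists (cocycle_dsum z) => // g /=.
rewrite -mxdiagZ !map_mxdiag ?rmorph0 // scale_mxdiag -mxdiagD mul_mxdiag.
by apply: eq_mxdiag => i; exact: rE.
Qed.

Hypothesis hom0 : forall i j, i <> j -> forall X : 'M[k]_(d j, d i),
  intertwiner (rhobar i) (rhobar j) X -> X = 0.
Variable D : forall i, rep_subcat W Fbar (d i).
Hypothesis D_def : forall i, deformation_condition (rhobar i) (@D i).

(** Makes the specialisation of epsilon to 0 a morphism of CNL algebras, so that (DC1) applies to
    it. *)
Definition dual_res_hom : cnl_hom (dual_cnl W) (k_cnl W).
Proof.
apply: (@CnlHom _ _ W (dual_cnl W) (k_cnl W) (@dual_res k)).
  by move=> w; exact: dual_resC.
by move=> a /dual_max_ideal a0; apply/field_max_ideal.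
Defined.

Lemma tangent_dsum_bij :
  set_bij [set c | forall i, tangent (rhobar i) (@D i) (c i)]
          (tangent rho (dsum_subcat D)) H1_dsum.
Proof.
split=> [c /= Tc|x y _ _|c [r [z zc rE] [rs Drs [M uM rM]]]].
- have /all_sig2[r rc Dr] i := cid2 (Tc i).
  exists (rep_dsum r); first exact: first_order_dsum.
  by exists r => //; exact: eq_equivalent.
- exact: H1_dsum_inj.
have rP g := (first_order_mxP _ _ _).1 (rE g).
have rMM g : r g *m M = M *m \mxdiag_i rs i g := (conj_unitmxP _ _ uM).1 (rM g).
(* Surjectivity. Modulo epsilon the change of basis intertwines two sums of lifts, so [Mb] is block
   diagonal; its constant lift [M0] can be absorbed into the summands. *)
pose Mb : 'M[k]_(\sum_i d i) := map_mx (@dual_res k) M.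
have uMb : Mb \in unitmx by exact: map_unitmx_rmorph.
have MbE : Mb = \mxdiag_i submxblock Mb i i.
  have Drb i := dc_map (D_def i) dual_res_hom (Drs i).
  have Dk i := dc0 (D_def i).
  apply: (mxdiag_intertwiner hom0 (A := k_cnl W) (lifts_D D_def Drb)
            (lifts_D D_def Dk)) => g.
  have := congr1 (map_mx (@dual_res k)) (rMM g).
  by rewrite !map_mxM (rP g).1 map_mxdiag ?rmorph0.
pose c0 i : 'M[dual k]_(d i) := map_mx (dual_const k) (submxblock Mb i i).
have uc0 i : c0 i \in unitmx.
  apply: map_unitmx_rmorph; move: i; apply/mxdiag_unitmx; by rewrite -MbE.
have /all_sig[rs' rs'E] i := cid (conj_rep (rs i) (uc0 i)).
have Drs' i : D (rs' i).
  apply: (dc_equivalent (D_def i) _ (Drs i)); apply: equivalent_sym.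
  by exists (c0 i).
pose M0 := \mxdiag_i c0 i.
have uM0 : M0 \in unitmx by exact/mxdiag_unitmx.
have resM0 : map_mx (@dual_res k) M0 = Mb.
  rewrite map_mxdiag ?rmorph0 // [RHS]MbE; apply: eq_mxdiag => i.
  exact: map_dual_resC.
pose N := M *m invmx M0.
have rN g : r g *m N = N *m \mxdiag_i rs' i g.
  rewrite mulmxA rMM /N -!mulmxA; congr (_ *m _).
  rewrite invmx_mxdiag // !mul_mxdiag; apply: eq_mxdiag => i.
  by rewrite rs'E !mulmxA mulVmx // mul1mx.
have resN : map_mx (@dual_res k) N = 1%:M.
  by rewrite map_mxM map_invmx_rmorph // resM0 mulmxV.
clearbody N.
(* Now [N = 1 + eps X], and the epsilon part of [rN] says that the block diagonal representation has
   cocycle [z] plus the coboundary of [X]. *)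
pose X := map_mx (@dual_im k) N.
pose z' : cocycle rho := z + Cocycle (coboundaryP rho X).
have z'E g : z' g = z g + (ad_act rho g X - X) by [].
have resR g : map_mx (@dual_res k) (\mxdiag_i rs' i g) = \mxdiag_i rhobar i g.
  have := congr1 (map_mx (@dual_res k)) (rN g).
  by rewrite !map_mxM resN mulmx1 mul1mx (rP g).1 => /esym.
have imR g : map_mx (@dual_im k) (\mxdiag_i rs' i g) = z' g *m \mxdiag_i rhobar i g.
  have := congr1 (map_mx (@dual_im k)) (rN g).
  rewrite !map_dual_imM resN mulmx1 mul1mx (rP g).1 (rP g).2 resR.
  move=> /esym/(canRL (addrK _)) ->.
  have ug : (rho g : 'M[k]_(\sum_i d i)) \in unitmx := rep_unitmx rho g.
  rewrite z'E mulmxDl mulmxBl /ad_act mulmxKV //.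
  by rewrite [in RHS]addrA [in LHS](addrC (_ *m _)).
(* The product of [z' g] with the block diagonal [rho g] is block diagonal; cancelling the
   invertible [rhobar j g] kills the off-diagonal blocks of [z' g]. *)
have [|zs zsE] := cocycle_block (z := z').
  move=> g i j ij; have := congr1 (fun M => submxblock M i j) (imR g).
  rewrite submxblock_mul_mxdiagr map_mxdiag ?raddf0 // submxblock_mxdiag_neq //.
  by move=> /esym/(congr1 (mulmx^~ (invmx (rhobar j g : 'M[k]_(d j)))));
    rewrite mul0mx mulmxK ?rho_unitmx.
exists (fun i => H1_class (zs i)) => [i /=|]; last first.
  rewrite H1_dsum_class -zsE -zc; apply/H1_classP; exists X => g.
  transitivity (z' g - z g) => //.
  by rewrite z'E addrC addKr.
exists (rs' i) => //; exists (zs i) => // g; apply/first_order_mxP; split.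
  by have := resR g; rewrite map_mxdiag ?rmorph0 // => /mxdiag_inj; apply.
have := imR g; rewrite map_mxdiag ?raddf0 // zsE mul_mxdiag => /mxdiag_inj.
exact.
Qed.

(** An invariant matrix is a self-intertwiner of [rho], hence block diagonal by the rigidity over
    [k]. *)
Lemma H0_dsum_bij : set_bij [set X | forall i, H0 (rhobar i) (X i)] (H0 rho)
  (fun X : forall i, 'M[k]_(d i) => \mxdiag_i X i).
Proof.
split=> [X /= HX g|X Y _ _ XY|Y HY].
- by rewrite ad_act_mxdiag; apply: eq_mxdiag => i; exact: HX.
- by apply: functional_extensionality_dep; exact: mxdiag_inj.
have YE : Y = \mxdiag_i submxblock Y i i.
  have Dk i := dc0 (D_def i).
  apply: (mxdiag_intertwiner hom0 (A := k_cnl W) (lifts_D D_def Dk)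
            (lifts_D D_def Dk)) => g.
  have ug : (rho g : 'M[k]_(\sum_i d i)) \in unitmx := rep_unitmx rho g.
  exact: (conj_unitmxP _ _ ug).1 (esym (HY g)).
exists (fun i => submxblock Y i i) => // i g.
by rewrite -[RHS](congr1 (fun M => submxblock M i i) (HY g)) submxblock_ad_act.
Qed.

Lemma dsum_well_behaved :
  (forall i, well_behaved (rhobar i) (@D i)) -> well_behaved rho (dsum_subcat D).
Proof.
move=> wD; split; first by apply: dsum_smooth => i; exact: (wD i).1.
(* The same [m i] measures the tangent space and the invariants of the [i]-th summand, so a single
   sum gives both dimensions. *)
have /all_sig[m mP] i := cid (wD i).2.
exists (\sum_i m i)%N; split.
  apply: has_dim_dsum H1_dsum_linear tangent_dsum_bij _ => i.
  exact: (mP i).1.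
apply: has_dim_dsum _ H0_dsum_bij _ => [a x y|i]; last exact: (mP i).2.
by rewrite scale_mxdiag -mxdiagD.
Qed.

End Tangent.
Theorem theorem4p4 (p ell : nat) (p_prime : prime p)
    (Qp : padicField p) (F : fieldExtType Qp) (Fbar : algClosure F)
    (k : finFieldType) (k_char : ell \in [pchar k]) (ell_neq_p : ell <> p)
    (W : wittRing k ell)
    (n : nat) (d : 'I_n -> nat)
    (rhobar : forall i, rep Fbar (k_cnl W) (d i))
    (hom0 : forall i j, i <> j -> forall (r : int) (X : 'M[k]_(d j, d i)),
       intertwiner (rhobar i) (twist (rhobar j) r) X -> X = 0)
    (D : forall i, rep_subcat W Fbar (d i))
    (D_def : forall i, deformation_condition (rhobar i) (D i)) :
  [/\ deformation_condition (rep_dsum rhobar) (dsum_subcat D),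
      exists Phi : (forall i, H1ad (rhobar i)) -> H1ad (rep_dsum rhobar),
        [/\ forall (a : k) x y,
              Phi (fun i => a *: x i + y i) = a *: Phi x + Phi y,
            forall (r : forall i, rep Fbar (dual_cnl W) (d i)) c,
              (forall i, first_order (r i) (c i)) ->
              first_order (rep_dsum r) (Phi c) &
            set_bij [set c | forall i, tangent (rhobar i) (D i) (c i)]
                    (tangent (rep_dsum rhobar) (dsum_subcat D)) Phi]
    & (forall i, well_behaved (rhobar i) (D i)) ->
      well_behaved (rep_dsum rhobar) (dsum_subcat D)].
Proof.
have hom0' i j : i <> j -> forall X : 'M[k]_(d j, d i),
    intertwiner (rhobar i) (rhobar j) X -> X = 0.
  (* The exponent 0 gives the trivial twist. *)
  move=> ij X Xint; apply: (hom0 i j ij 0) => g.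
  by rewrite /twist expr0z scale1r; exact: Xint.
split.
- exact: dsum_deformation_condition.
- exists (@H1_dsum _ _ _ _ _ _ _ rhobar); split.
  + exact: H1_dsum_linear.
  + exact: first_order_dsum.
  + exact: tangent_dsum_bij.
- exact: dsum_well_behaved.
Qed.
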